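(* Let $\eta_1,\eta_2>0$, $p\ge1$, and let $p'$ be the conjugate exponent of $p$. For each $c\in\{-1,0,1\}$ there is a constant $K>0$ depending only on $p,\eta_1,\eta_2$ and $c$ such that for all $0<a<b<\frac{1}{1-H(-c)}$, $$(1-ca)^{-\frac{H(c)+1}{2p'}}a^{\frac{1-H(c)}{2p'}}\left(1-\frac ab\right)^{\frac1{p'}}F_1\left(1;1+\frac{\eta_1+\eta_2}{2}-H(c),\frac{H(c)+1-\eta_2}{2};2;1-\frac ab,\frac{b-a}{(1-ca)b}\right)$$ $$\le K\left[F_1\left(1;1-H(c)+p\left(\frac{\eta_1+\eta_2}{2}\right),\frac{H(c)+1-p\eta_2}{2};2;1-\frac ab,\frac{b-a}{(1-ca)b}\right)\right]^{\frac1p}.$$ As special cases, with constants $K$ depending only on $p,\eta_1,\eta_2$: for all $0<a<b<\infty$, $$\left(\frac{a}{1+a}\right)^{\frac1{2p'}}\left(1-\frac ab\right)^{\frac1{p'}}F_1\left(1;1+\frac{\eta_1+\eta_2}{2},\frac{1-\eta_2}{2};2;1-\frac ab,\frac{b-a}{(1+a)b}\right)\le K\left[F_1\left(1;1+p\left(\frac{\eta_1+\eta_2}{2}\right),\frac{1-p\eta_2}{2};2;1-\frac ab,\frac{b-a}{(1+a)b}\right)\right]^{\frac1p},$$ $$\left(1-\frac ab\right)^{\frac1{p'}}F_1\left(1;\frac{\eta_1+\eta_2}{2},1-\frac{\eta_2}{2};2;1-\frac ab,1-\frac ab\right)\le K\left[F_1\left(1;p\left(\frac{\eta_1+\eta_2}{2}\right),1-\frac{p\eta_2}{2};2;1-\frac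 ab,1-\frac ab\right)\right]^{\frac1p},$$ and $$\left(1-\frac ab\right)^{\frac1{p'}}{}_2F_1\left(1+\frac{\eta_1}{2},1;2;1-\frac ab\right)\le K\left[{}_2F_1\left(1+\frac{p\eta_1}{2},1;2;1-\frac ab\right)\right]^{\frac1p};$$ and for all $0<a<b<1$, $$(1-a)^{-\frac1{p'}}\left(1-\frac ab\right)^{\frac1{p'}}F_1\left(1;\frac{\eta_1+\eta_2}{2},1-\frac{\eta_2}{2};2;1-\frac ab,\frac{b-a}{(1-a)b}\right)\le K\left[F_1\left(1;p\left(\frac{\eta_1+\eta_2}{2}\right),1-\frac{p\eta_2}{2};2;1-\frac ab,\frac{b-a}{(1-a)b}\right)\right]^{\frac1p}.$$
   Context: $H$ is the Heaviside function: $H(s)=1$ for $s\ge0$ and $H(s)=0$ for $s<0$. The bound $\frac{1}{1-H(-c)}$ is read as $+\infty$ when $H(-c)=1$ (i.e. $c=0,-1$), and equals $1$ for $c=1$. The conjugate exponent satisfies $\frac1p+\frac1{p'}=1$, with $\frac1{p'}=0$ for $p=1$. Appell's hypergeometric function of the first kind is $$F_1(\alpha;\beta_1,\beta_2;\gamma;x,y)=\frac{\Gamma(\gamma)}{\Gamma(\alpha)\Gamma(\gamma-\alpha)}\int_0^1\frac{u^{\alpha-1}(1-u)^{\gamma-\alpha-1}}{(1-ux)^{\beta_1}(1-uy)^{\beta_2}}\,\mathrm{d}u,$$ for $\mathrm{Re}\,\alpha>0$, $\mathrm{Re}(\gamma-\alpha)>0$, $x,y\notin[1,\infty)$. Gauss'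 hypergeometric function is $${}_2F_1(\alpha,\beta;\gamma;z)=\frac{\Gamma(\gamma)}{\Gamma(\beta)\Gamma(\gamma-\beta)}\int_0^1\frac{u^{\beta-1}(1-u)^{\gamma-\beta-1}}{(1-zu)^\alpha}\,\mathrm{d}u,$$ for $\mathrm{Re}\,\gamma>\mathrm{Re}\,\beta>0$, $z\notin[1,\infty)$ (the symmetric extension in $\alpha,\beta$ is not needed here). *)

(* Defs.v *)
From mathcomp Require Import all_boot all_order all_algebra.
From mathcomp Require Import all_classical all_reals all_analysis.

Set Implicit Arguments.
Unset Strict Implicit.
Unset Printing Implicit Defensive.
Import Order.TTheory GRing.Theory Num.Theory.

Local Open Scope classical_set_scope.
Local Open Scope ring_scope.

Definition heaviside {R : realType} (s : R) : R := if 0 <= s then 1 else 0.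

(* Euler's integral, meaningful for s > 0. *)
Definition Gamma {R : realType} (s : R) : R :=
  \int[@lebesgue_measure R]_(t in `]0, +oo[) (t `^ (s - 1) * expR (- t)).

(* The parameters and the variables of the two functions below are real.
   The integral representations are meaningful for 0 < alpha < gamma,
   x < 1 and y < 1 (resp. 0 < beta < gamma and z < 1): the bases of the real
   powers are then nonnegative and the integrals converge absolutely. *)
Definition appellF1 {R : realType} (alpha beta1 beta2 gamma x y : R) : R :=
  Gamma gamma / (Gamma alpha * Gamma (gamma - alpha)) *
  \int[@lebesgue_measure R]_(u in `[0, 1])
    (u `^ (alpha - 1) * (1 - u) `^ (gamma - alpha - 1) /
     ((1 - u * x) `^ beta1 * (1 - u * y) `^ beta2)).

Definition gauss2F1 {R : realType} (alpha beta gamma z : R) : R :=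
  Gamma gamma / (Gamma beta * Gamma (gamma - beta)) *
  \int[@lebesgue_measure R]_(u in `[0, 1])
    (u `^ (beta - 1) * (1 - u) `^ (gamma - beta - 1) /
     (1 - z * u) `^ alpha).

(* 1 / p' for the conjugate exponent p' of p; p' = +oo and 1 / p' = 0 when
   p = 1. *)
Definition inv_conjugate {R : realType} (p : R) : R :=
  fine (hoelder_conjugate p%:E)^-1%E.

(* Main.v *)
Require Import Defs.
From mathcomp Require Import all_boot all_order all_algebra.
From mathcomp Require Import all_classical all_reals all_analysis.
From mathcomp Require Import ring lra.
Import Order.TTheory GRing.Theory Num.Theory.
Import numFieldNormedType.Exports.
Local Open Scope ring_scope.

(** Put X = 1 - u x and Y = 1 - u y. Both sides are integrals over [0, 1]: with
    f = X ^ -s Y ^ b and w = X ^ -i Y ^ -j, the claim reads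
    L ^ (1 - 1/p) * int f w <= K (int f ^ p w) ^ (1/p) for some L > 0 given by
    the prefactors. Hoelder's inequality alone is not enough since the mass of w
    is unbounded, but f grows or decays exponentially with respect to L w: for
    every threshold tau the part of [0, 1] where f <= tau contributes at most
    C tau to int L f w, while f <= f ^ p tau ^ (1 - p) elsewhere. It remains to
    choose tau = (L int f ^ p w) ^ (1/p). *)

Section AppellReverseBound.
Set Implicit Arguments.
Unset Strict Implicit.
Unset Printing Implicit Defensive.
Local Open Scope classical_set_scope.
Context {R : realType}.
Implicit Types (f g w : R -> R) (x y u q r : R).
Notation mu := (@lebesgue_measure R).

(** * Calculus on the unit interval *)

Lemma is_derive_continuous f u (d : R) :
  is_derive u (1 : R) f d -> {for u, continuous f}.
Proof. by move=> fd; apply/differentiable_continuous/derivable1_diffP. Qed.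

Lemma within01_continuous f :
  (forall u, 0 <= u <= 1 -> {for u, continuous f}) ->
  {within `[0, 1], continuous f}.
Proof.
move=> cf; apply: continuous_in_subspaceT => u; rewrite inE/= in_itv/=.
exact: cf.
Qed.

Lemma continuous01_integrable f :
  (forall u, 0 <= u <= 1 -> {for u, continuous f}) ->
  mu.-integrable `[0, 1] (EFin \o f).
Proof.
move=> cf; apply: continuous_compact_integrable; first exact: segment_compact.
exact: within01_continuous.
Qed.

(** Two-sided differentiability is asked at 0 and 1 as well: the functions integrated here extend
    smoothly beyond [0, 1], and this supplies the one-sided limits of the fundamental theorem of
    calculus. *)
Lemma Rintegral01_derivative f g :
  (forall u, 0 <= u <= 1 -> is_derive u (1 : R) f (g u)) ->
  (forall u, 0 <= u <= 1 -> {for u, continuous g}) ->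
  \int[mu]_(u in `[0, 1]) g u = f 1 - f 0.
Proof.
move=> df cg.
have cf u : 0 <= u <= 1 -> {for u, continuous f}.
  by move=> /df /is_derive_continuous.
rewrite /Rintegral (@continuous_FTC2 _ g f)//; first exact: within01_continuous.
  split.
  - move=> u; rewrite in_itv/= => /andP[/ltW u0 /ltW u1].
    by have := df u; rewrite u0 u1 => /(_ isT) [].
  - by apply: cvg_at_right_filter; apply: cf; rewrite lexx ler01.
  - by apply: cvg_at_left_filter; apply: cf; rewrite lexx ler01.
move=> u; rewrite in_itv/= => /andP[/ltW u0 /ltW u1].
rewrite derive1E; have := df u; rewrite u0 u1 => /(_ isT) fu.
exact: derive_val.
Qed.

Lemma continuous_at_powR f (r : R) u : 0 < f u ->
  {for u, continuous f} -> {for u, continuous (fun v => f v `^ r)}.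
Proof.
move=> fu cf; apply: (@continuous_comp _ _ _ f (@powR R ^~ r)) => //.
exact: (is_derive_continuous (is_derive1_powR r fu)).
Qed.

(** * From a threshold estimate to a power inequality *)

Lemma inv_conjugateE (p : R) : 1 <= p -> inv_conjugate p = 1 - p^-1.
Proof.
move=> p1; have p0 : p != 0 by rewrite gt_eqF// (lt_le_trans ltr01).
have /= := @hoelder_conjugate_eq1 R p%:E (ltNyr p).
rewrite eqe p0 => /(_ isT); rewrite inver (negbTE p0) /inv_conjugate.
case: ((hoelder_conjugate p%:E)^-1)%E => //= r [] <-.
by rewrite addrC addrK.
Qed.

(** At tau = (L S) ^ (1/p) the term L tau ^ (1 - p) S equals tau, so that L I <= (1 + C) (L S) ^
    (1/p); dividing by L ^ (1/p) gives the claim. *)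
Lemma optimize_threshold (p L I S C : R) :
  1 <= p -> 0 < L -> 0 <= S -> 0 <= C ->
  (forall tau, 0 < tau -> L * I <= L * tau `^ (1 - p) * S + C * tau) ->
  L `^ (1 - p^-1) * I <= (1 + C) * S `^ p^-1.
Proof.
move=> p1 L0 S0 C0 H.
have p0 : 0 < p by rewrite (lt_le_trans ltr01).
move: S0; rewrite le_eqVlt => /predU1P[S0|S0].
  (* For S = 0 that threshold would be 0. Instead tau = e / (C + 1) with e arbitrarily small gives L
     I <= 0; the summand 1 covers C = 0. *)
  rewrite -S0 powR0 ?gt_eqF ?invr_gt0// mulr0.
  have LI : L * I <= 0.
    apply/ler_addgt0Pr => e e0; rewrite add0r.
    have C1 : 0 < C + 1 by lra.
    have := H _ (divr_gt0 e0 C1); rewrite -S0 mulr0 add0r => /le_trans; apply.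
    by rewrite mulrCA ger_pMr// ler_pdivrMr// mul1r lerDl.
  by rewrite mulr_ge0_le0 ?powR_ge0//; move: LI; rewrite pmulr_rle0.
have LS : 0 < L * S by rewrite mulr_gt0.
have t0 : 0 < (L * S) `^ p^-1 by rewrite powR_gt0.
have := H _ t0; rewrite mulrAC.
(* The exponents add up: 1 + (1 - p) / p = 1 / p. *)
have -> : L * S * (L * S) `^ p^-1 `^ (1 - p) = (L * S) `^ p^-1.
  rewrite -{1}[L * S]powRr1 ?(ltW LS)// -powRrM -powRD; last first.
    by rewrite (gt_eqF LS) implybT.
  by congr (_ `^ _); field; rewrite gt_eqF.
rewrite powRM ?(ltW L0) ?(ltW S0)// => LI.
rewrite powRB; last by rewrite (gt_eqF L0) implybT.
rewrite powRr1 ?(ltW L0)// mulrAC ler_pdivrMr ?powR_gt0//.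
by apply: (le_trans LI); rewrite le_eqVlt; apply/orP; left; apply/eqP; ring.
Qed.

(* The function v |-> tau - tau ^ 2 / (tau + v) = v tau / (tau + v) is a smooth
   substitute for min(v, tau): bounded by tau, with derivative of order 1 where
   v = O(tau). *)
Lemma is_derive_saturation g (tau u d : R) : 0 < tau -> 0 <= g u ->
  is_derive u (1 : R) g d ->
  is_derive u (1 : R) (fun v => tau - tau ^+ 2 * (tau + g v)^-1)
    (tau ^+ 2 * d * (tau + g u) ^- 2).
Proof.
move=> t0 gu gd.
have n0 : cst tau u + g u != 0 by rewrite /cst gt_eqF// ltr_wpDr.
have h1 : is_derive u (1 : R) (cst tau + g) (0 + d) by apply: is_deriveD.
have h2 := @is_deriveV R (cst tau + g) u _ 1 n0 h1.
have h3 := @is_deriveZ _ _ _ _ (tau ^+ 2) _ _ _ h2.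
have h4 := is_deriveB (is_derive_cst tau u (1 : R)) h3.
apply: is_derive_eq h4 _.
rewrite -[LHS]/(0 - tau ^+ 2 * (- (tau + g u) ^- 2 * (0 + d))).
by field; rewrite gt_eqF// ltr_wpDr.
Qed.

(** [g1] increases, [g2] decreases, and at each point one of them controls L f w by its derivative
    while being at most B f. Where f <= tau, saturating that function at level tau costs only a
    constant factor in the derivative, and the saturated functions vary by at most tau in total.
    This yields the hypothesis of [optimize_threshold] with C = 2 kappa (1 + B) ^ 2. *)
Lemma threshold_bound f w g1 g2 (d1 d2 : R -> R) (p L kappa B : R) :
  1 <= p -> 0 < L -> 0 <= kappa -> 0 <= B ->
  (forall u, 0 <= u <= 1 ->
    [/\ {for u, continuous f}, {for u, continuous w},
        {for u, continuous d1} & {for u, continuous d2}]) ->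
  (forall u, 0 <= u <= 1 -> 0 < f u /\ 0 <= w u) ->
  (forall u, 0 <= u <= 1 -> is_derive u (1 : R) g1 (d1 u)) ->
  (forall u, 0 <= u <= 1 -> is_derive u (1 : R) g2 (d2 u)) ->
  (forall u, 0 <= u <= 1 -> [/\ 0 <= g1 u, 0 <= g2 u, 0 <= d1 u & d2 u <= 0]) ->
  (forall u, 0 <= u <= 1 ->
     L * (f u * w u) <= kappa * d1 u /\ g1 u <= B * f u \/
     L * (f u * w u) <= - (kappa * d2 u) /\ g2 u <= B * f u) ->
  L `^ (1 - p^-1) * \int[mu]_(u in `[0, 1]) (f u * w u) <=
  (1 + 2 * kappa * (1 + B) ^+ 2) *
    (\int[mu]_(u in `[0, 1]) (f u `^ p * w u)) `^ p^-1.
Proof.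
move=> p1 L0 k0 B0 cfw fw0 g1d g2d gd0 fwd.
have fpw0 u : 0 <= u <= 1 -> 0 <= f u `^ p * w u.
  by move=> /fw0[fu wu]; rewrite mulr_ge0// powR_ge0.
have B1 : 0 < 1 + B by lra.
apply: optimize_threshold => //.
- by apply: Rintegral_ge0 => u; rewrite /= in_itv/= => /fpw0.
- by rewrite !mulr_ge0 // ltW.
move=> tau t0.
(* Saturation multiplies the derivative by (tau / (tau + g)) ^ 2, which is at least (1 + B) ^ -2
   when g <= B tau; [M] compensates for this loss. *)
pose M := kappa * (1 + B) ^+ 2.
have M0 : 0 <= M by rewrite mulr_ge0// sqr_ge0.
pose h g (v : R) : R := tau - tau ^+ 2 * (tau + g v)^-1.
pose h' g d (v : R) : R := tau ^+ 2 * d v * (tau + g v) ^- 2.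
(* [Q] is nondecreasing, and its derivative [D] will dominate L f w wherever f <= tau. *)
pose Q v := M * h g1 v - M * h g2 v.
pose D v := M * h' g1 d1 v - M * h' g2 d2 v.
have QD u : 0 <= u <= 1 -> is_derive u (1 : R) Q (D u).
  move=> u01; have [g10 g20 _ _] := gd0 _ u01.
  have h1 := is_derive_saturation t0 g10 (g1d _ u01).
  have h2 := is_derive_saturation t0 g20 (g2d _ u01).
  exact: (is_deriveB (@is_deriveZ _ _ _ _ M _ _ _ h1)
                     (@is_deriveZ _ _ _ _ M _ _ _ h2)).
have cont g d u : 0 <= g u -> is_derive u (1 : R) g (d u) ->
    {for u, continuous d} -> {for u, continuous (h' g d)}.
  move=> gu gdu cd.
  have cg : {for u, continuous g}.
    exact: is_derive_continuous gdu.
  apply: cvgM; first by apply: cvgM => //; exact: cvg_cst.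
  apply: cvgV; first by rewrite expf_neq0// gt_eqF// ltr_wpDr.
  by apply: cvgM; (apply: cvgD => //; exact: cvg_cst).
have cD u : 0 <= u <= 1 -> {for u, continuous D}.
  move=> u01; have [g10 g20 _ _] := gd0 _ u01; have [_ _ c1 c2] := cfw _ u01.
  by apply: cvgB; apply: cvgM; [exact: cvg_cst | apply: cont => //; auto
    | exact: cvg_cst | apply: cont => //; auto].
have cfwu u : 0 <= u <= 1 -> {for u, continuous (fun u => f u * w u)}.
  by move=> u01; have [cf cw _ _] := cfw _ u01; exact: cvgM.
have cfpw u : 0 <= u <= 1 -> {for u, continuous (fun u => f u `^ p * w u)}.
  move=> u01; have [cf cw _ _] := cfw _ u01.
  exact: (cvgM (continuous_at_powR (fw0 _ u01).1 cf) cw).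
have pw u : 0 <= u <= 1 ->
    L * (f u * w u) <= L * tau `^ (1 - p) * (f u `^ p * w u) + D u.
  move=> u01; have [fu wu] := fw0 _ u01; have [g10 g20 d10 d20] := gd0 _ u01.
  have D1 : 0 <= h' g1 d1 u.
    by rewrite mulr_ge0// ?invr_ge0 ?sqr_ge0// mulr_ge0// sqr_ge0.
  have D2 : 0 <= - h' g2 d2 u.
    rewrite -mulNr mulr_ge0// ?invr_ge0 ?sqr_ge0//.
    by rewrite -mulrN mulr_ge0 ?sqr_ge0// oppr_ge0.
  have DE : D u = M * h' g1 d1 u + M * - h' g2 d2 u by rewrite mulrN.
  (* Where f > tau, the first term suffices since (f / tau) ^ (p - 1) >= 1, and D >= 0 can be
     added. *)
  have [ft|tf] := leP (f u) tau; last first.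
    apply: (@le_trans _ _ (L * tau `^ (1 - p) * (f u `^ p * w u))).
      rewrite -mulrA ler_pM2l// mulrA ler_wpM2r// .
      have -> : f u `^ p = f u `^ (p - 1) * f u.
        by rewrite mulrC mulr_powRB1 ?(ltW fu)// (lt_le_trans ltr01).
      rewrite mulrA ler_pMl// -opprB powRN mulrC ler_pdivlMr ?powR_gt0// mul1r.
      by rewrite ge0_ler_powR ?nnegrE ?subr_ge0// ltW.
    by rewrite lerDl DE addr_ge0// mulr_ge0.
  suff : L * (f u * w u) <= D u.
    move=> /le_trans; apply; rewrite lerDr mulr_ge0 ?fpw0//.
    by rewrite mulr_ge0 ?powR_ge0// ltW.
  (* Here f <= tau, hence tau + g <= (1 + B) tau. *)
  have key (g v : R) : 0 <= v -> 0 <= g -> g <= B * f u ->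
      kappa * v <= M * (tau ^+ 2 * v * (tau + g) ^- 2).
    move=> v0 gp gB.
    have tg : 0 < tau + g by rewrite ltr_wpDr.
    rewrite /M mulrA ler_pdivlMr ?exprn_gt0//.
    rewrite (_ : _ * (_ * v) = kappa * v * ((1 + B) * tau) ^+ 2); last by ring.
    rewrite ler_wpM2l ?mulr_ge0// ler_sqr ?nnegrE ?(ltW tg)//; last first.
      by rewrite mulr_ge0 ?(ltW B1) ?(ltW t0).
    rewrite mulrDl mul1r lerD2l (le_trans gB)// ler_wpM2l//.
  rewrite DE; have [[le1 gB]|[le2 gB]] := fwd _ u01.
    apply: (le_trans le1); rewrite ler_wpDr ?(mulr_ge0 M0)//.
    exact: key.
  apply: (le_trans le2); rewrite ler_wpDl ?(mulr_ge0 M0)//.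
  rewrite -mulrN (_ : - h' _ _ _ = tau ^+ 2 * (- d2 u) * (tau + g2 u) ^- 2).
    by apply: key => //; rewrite oppr_ge0.
  by rewrite /h'; ring.
have ifw := continuous01_integrable cfwu.
have ifpw := continuous01_integrable cfpw.
have iD := continuous01_integrable cD.
have m01 : measurable (`[0%R, 1%R] : set R) by [].
have iL : mu.-integrable `[0, 1] (EFin \o (fun u => L * (f u * w u))).
  by apply: continuous01_integrable => u /cfwu; apply: cvgM; exact: cvg_cst.
have iT : mu.-integrable `[0, 1]
    (EFin \o (fun u => L * tau `^ (1 - p) * (f u `^ p * w u))).
  by apply: continuous01_integrable => u /cfpw; apply: cvgM; exact: cvg_cst.
rewrite -RintegralZl//.
have iTD : mu.-integrable `[0, 1]
    (EFin \o (fun u => L * tau `^ (1 - p) * (f u `^ p * w u) + D u)).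
  by apply: continuous01_integrable => u u01; apply: cvgD; [apply: cvgM;
    [exact: cvg_cst|exact: cfpw]|exact: cD].
apply: (@le_trans _ _ (\int[mu]_(u in `[0, 1])
    (L * tau `^ (1 - p) * (f u `^ p * w u) + D u))).
  by apply: le_Rintegral => // u; rewrite /= in_itv/= => /pw.
rewrite RintegralD// RintegralZl// lerD2l (Rintegral01_derivative QD cD).
(* Both saturations take values in [0, tau], so Q 1 - Q 0 <= 2 M tau. *)
have hb g v : 0 <= g v -> 0 <= h g v <= tau.
  move=> gv; have tg : 0 < tau + g v by rewrite ltr_wpDr.
  rewrite /h subr_ge0 ler_pdivrMr// expr2 ler_pM2l// lerDl gv/=.
  by rewrite gerBl divr_ge0 ?(ltW tg) ?sqr_ge0.
have in0 : 0 <= (0 : R) <= 1 by rewrite lexx ler01.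
have in1 : 0 <= (1 : R) <= 1 by rewrite lexx ler01.
have [/hb/andP[a1 a2] /hb/andP[a3 a4] _ _] := gd0 _ in0.
have [/hb/andP[b1 b2] /hb/andP[b3 b4] _ _] := gd0 _ in1.
rewrite /Q (_ : 2 * _ * _ * _ = M * (2 * tau)); last by rewrite /M; ring.
rewrite (_ : _ - _ - _ = M * (h g1 1 - h g2 1 - h g1 0 + h g2 0)); last by ring.
by apply: ler_wpM2l => //; lra.
Qed.

(** * Products of powers of 1 - u x and 1 - u y *)

Lemma onem_mul_gt0 x u : x < 1 -> 0 <= u <= 1 -> 0 < 1 - u * x.
Proof.
move=> x1 /andP[u0 u1]; have [x0|x0] := leP 0 x.
  by rewrite subr_gt0 (le_lt_trans _ x1)// ler_piMl.
by rewrite subr_gt0 (@le_lt_trans _ _ 0)// mulr_ge0_le0// ltW.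
Qed.

(** The common form of both integrands, of f and w, and, up to constants, of the auxiliary functions
    [g1] and [g2]. The family is closed under products and real powers. *)
Definition appell_factor x y q r u : R := (1 - u * x) `^ q * (1 - u * y) `^ r.

Lemma is_derive_onem_mul x u : is_derive u (1 : R) (fun v => 1 - v * x) (- x).
Proof.
have h := is_deriveB (is_derive_cst (1 : R) u (1 : R))
  (is_deriveM (is_derive_id u (1 : R)) (is_derive_cst x u (1 : R))).
by apply: is_derive_eq h _; rewrite /GRing.scale/= /cst; ring.
Qed.

Lemma is_derive_onem_mul_powR x q u : 0 < 1 - u * x ->
  is_derive u (1 : R) (fun v => (1 - v * x) `^ q)
    ((1 - u * x) `^ q * (- (q * (x / (1 - u * x))))).
Proof.
move=> X0.
have h := @is_derive1_comp R (@powR R ^~ q) (fun v => 1 - v * x) _ _ _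
  (is_derive1_powR q X0) (is_derive_onem_mul x u).
apply: is_derive_eq h _.
rewrite powRB; last by rewrite (gt_eqF X0) implybT.
rewrite powRr1 ?(ltW X0)//; field.
by rewrite gt_eqF.
Qed.

(** The derivative is written as the function times its logarithmic derivative, so that its sign is
    that of the last factor when k > 0. *)
Lemma is_derive_appell_factor x y q r (k : R) u :
  0 < 1 - u * x -> 0 < 1 - u * y ->
  is_derive u (1 : R) (fun v => k * appell_factor x y q r v)
    (k * appell_factor x y q r u *
     (- (q * (x / (1 - u * x))) - r * (y / (1 - u * y)))).
Proof.
move=> X0 Y0.
have h := @is_deriveZ _ _ _ _ k _ _ _ (is_deriveM (is_derive_onem_mul_powR q X0)
            (is_derive_onem_mul_powR r Y0)).
by apply: is_derive_eq h _; rewrite /GRing.scale/= /appell_factor; ring.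
Qed.

Lemma continuous_onem_mulV x u : 0 < 1 - u * x ->
  {for u, continuous (fun v : R => x / (1 - v * x))}.
Proof.
move=> X0; apply: cvgM; first exact: cvg_cst.
apply: cvgV; first by rewrite gt_eqF.
exact: (is_derive_continuous (is_derive_onem_mul x u)).
Qed.

Lemma continuous_appell_factor x y q r u :
  0 < 1 - u * x -> 0 < 1 - u * y -> {for u, continuous (appell_factor x y q r)}.
Proof.
by move=> X0 Y0; apply: cvgM; [
  exact: (is_derive_continuous (is_derive_onem_mul_powR q X0))|
  exact: (is_derive_continuous (is_derive_onem_mul_powR r Y0))].
Qed.

Lemma appell_factor_gt0 x y q r u :
  0 < 1 - u * x -> 0 < 1 - u * y -> 0 < appell_factor x y q r u.
Proof. by move=> X0 Y0; rewrite mulr_gt0// powR_gt0. Qed.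

Lemma appell_factorM x y q r q' r' u : 0 < 1 - u * x -> 0 < 1 - u * y ->
  appell_factor x y q r u * appell_factor x y q' r' u =
  appell_factor x y (q + q') (r + r') u.
Proof.
move=> X0 Y0; rewrite /appell_factor mulrACA.
by rewrite -!powRD// ?(gt_eqF X0) ?(gt_eqF Y0) ?implybT.
Qed.

Lemma appell_factor_powR x y q r (p : R) u : 0 < 1 - u * x -> 0 < 1 - u * y ->
  appell_factor x y q r u `^ p = appell_factor x y (p * q) (p * r) u.
Proof.
by move=> *; rewrite /appell_factor powRM ?powR_ge0// -!powRrM ![p * _]mulrC.
Qed.

(** * The hypergeometric functions as integrals of these products *)

Definition appell_const : R := Gamma 2 / (Gamma 1 * Gamma (2 - 1)).

Lemma Gamma_ge0 (s : R) : 0 <= Gamma s.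
Proof.
by apply: Rintegral_ge0 => t _; rewrite mulr_ge0 ?powR_ge0 ?expR_ge0.
Qed.

Lemma appell_const_ge0 : 0 <= appell_const.
Proof. by rewrite divr_ge0 ?mulr_ge0 ?Gamma_ge0. Qed.

Lemma appellF1_factor (b1 b2 x y : R) :
  appellF1 1 b1 b2 2 x y =
  appell_const * \int[mu]_(u in `[0, 1]) appell_factor x y (- b1) (- b2) u.
Proof.
rewrite /appellF1 -/appell_const; congr (_ * _).
apply: eq_Rintegral => u _.
rewrite (_ : 2 - 1 - 1 = 0 :> R) ?subrr ?powRr0 ?mul1r; last by ring.
by rewrite /appell_factor invfM !powRN.
Qed.

(** On the diagonal x = y the two factors of the integrand merge, their common base being positive;
    Gauss' function thus becomes a case of Appell's. *)
Lemma gauss2F1_factor (b1 b2 z : R) : z < 1 ->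
  gauss2F1 (b1 + b2) 1 2 z = appellF1 1 b1 b2 2 z z.
Proof.
move=> z1; rewrite appellF1_factor /gauss2F1 -/appell_const; congr (_ * _).
apply: eq_Rintegral => u; rewrite inE/= in_itv/= => u01.
have X0 := onem_mul_gt0 z1 u01.
rewrite (_ : 2 - 1 - 1 = 0 :> R) ?subrr ?powRr0 ?mul1r; last by ring.
by rewrite -powRN opprD [z * u]mulrC powRD// (gt_eqF X0) implybT.
Qed.

(** The first factor is 1 + C from [threshold_bound]; the second absorbs the normalising constant,
    which enters linearly on the left and to the power 1/p on the right. Neither involves x or y. *)
Definition appell_bound (p kappa B : R) : R :=
  (1 + 2 * kappa * (1 + B) ^+ 2) * (1 + appell_const `^ (1 - p^-1)).

Lemma appell_bound_gt0 (p kappa B : R) :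
  0 <= kappa -> 0 <= B -> 0 < appell_bound p kappa B.
Proof.
move=> k0 B0; apply: mulr_gt0; apply: ltr_wpDr => //; last exact: powR_ge0.
by rewrite !mulr_ge0// addr_ge0.
Qed.

(** With f = X ^ -s Y ^ b and w = X ^ -i Y ^ -j, the integrands of the two sides are f w and f ^ p
    w. The functions [g1] and [g2] have derivatives g1 l1 and - g2 l2, so the hypothesis is that of
    [threshold_bound] in terms of logarithmic derivatives. *)
Lemma appellF1_threshold (x y s b i j q1 r1 q2 r2 k1 k2 p L kappa B : R) :
  x < 1 -> y < 1 -> 1 <= p -> 0 < L -> 0 <= kappa -> 0 <= B ->
  0 <= k1 -> 0 <= k2 ->
  (forall u, 0 <= u <= 1 ->
    let X := 1 - u * x in let Y := 1 - u * y in
    let f := appell_factor x y (- s) b u in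
    let w := appell_factor x y (- i) (- j) u in
    let g1 := k1 * appell_factor x y (- q1) r1 u in
    let g2 := k2 * appell_factor x y (- q2) r2 u in
    let l1 := q1 * (x / X) - r1 * (y / Y) in
    let l2 := r2 * (y / Y) - q2 * (x / X) in
    [/\ 0 <= l1, 0 <= l2 &
      L * (f * w) <= kappa * (g1 * l1) /\ g1 <= B * f \/
      L * (f * w) <= kappa * (g2 * l2) /\ g2 <= B * f]) ->
  L `^ (1 - p^-1) * appellF1 1 (i + s) (j - b) 2 x y <=
  appell_bound p kappa B *
    appellF1 1 (i + p * s) (j - p * b) 2 x y `^ p^-1.
Proof.
move=> x1 y1 p1 L0 kap0 B0 k10 k20 H.
have X0 := onem_mul_gt0 x1; have Y0 := onem_mul_gt0 y1.
rewrite !appellF1_factor.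
set f := appell_factor x y (- s) b.
set w := appell_factor x y (- i) (- j).
rewrite (_ : \int[_]_(_ in _) _ =
    \int[mu]_(u in `[0, 1]) (f u * w u)); last first.
  apply: eq_Rintegral => u; rewrite inE/= in_itv/= => u01.
  by rewrite appell_factorM ?X0 ?Y0//; congr appell_factor; ring.
rewrite [in leRHS](_ : \int[_]_(_ in _) _ =
    \int[mu]_(u in `[0, 1]) (f u `^ p * w u)); last first.
  apply: eq_Rintegral => u; rewrite inE/= in_itv/= => u01.
  rewrite appell_factor_powR ?appell_factorM ?X0 ?Y0//.
  by congr appell_factor; ring.
have fac0 q r u : 0 <= u <= 1 -> 0 <= appell_factor x y q r u.
  by move=> u01; apply/ltW/appell_factor_gt0; [exact: X0|exact: Y0].
have main : L `^ (1 - p^-1) * \int[mu]_(u in `[0, 1]) (f u * w u) <=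
  (1 + 2 * kappa * (1 + B) ^+ 2) *
    (\int[mu]_(u in `[0, 1]) (f u `^ p * w u)) `^ p^-1.
  pose g q r k u := k * appell_factor x y (- q) r u.
  pose d q r k u := k * appell_factor x y (- q) r u *
     (- (- q * (x / (1 - u * x))) - r * (y / (1 - u * y))).
  have dE q r k u : d q r k u =
      g q r k u * (q * (x / (1 - u * x)) - r * (y / (1 - u * y))).
    by rewrite /d mulNr opprK.
  have cd q r k u : 0 <= u <= 1 -> {for u, continuous (d q r k)}.
    move=> u01; apply: cvgM.
      apply: cvgM; first exact: cvg_cst.
      exact: continuous_appell_factor (X0 _ u01) (Y0 _ u01).
    by apply: cvgB; [apply: cvgN|]; apply: cvgM; (try exact: cvg_cst);
      apply: continuous_onem_mulV; [exact: X0|exact: Y0].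
  apply: (@threshold_bound f w (g q1 r1 k1) (g q2 r2 k2)
    (d q1 r1 k1) (d q2 r2 k2)) => //.
  - move=> u u01; split; try exact: cd;
      exact: continuous_appell_factor (X0 _ u01) (Y0 _ u01).
  - move=> u u01; split; [|apply: ltW];
      exact: appell_factor_gt0 (X0 _ u01) (Y0 _ u01).
  - move=> u u01; exact: is_derive_appell_factor (X0 _ u01) (Y0 _ u01).
  - move=> u u01; exact: is_derive_appell_factor (X0 _ u01) (Y0 _ u01).
  - move=> u u01; have [l1 l2 _] := H _ u01.
    have g0 q r k : 0 <= k -> 0 <= g q r k u.
      move=> ?; apply: mulr_ge0 => //; apply: ltW.
      exact: appell_factor_gt0 (X0 _ u01) (Y0 _ u01).
    rewrite !dE; split; try exact: g0; first exact: (mulr_ge0 (g0 _ _ _ k10)).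
    by apply: mulr_ge0_le0; [exact: g0|lra].
  - move=> u u01; have [_ _] := H _ u01.
    rewrite !dE; case=> -[h1 h2]; [left|right]; split=> //.
    by rewrite -mulrN -[X in _ <= _ * X]mulrN opprB.
have A0 := appell_const_ge0.
(* For A > 0 this is A = A ^ (1 - 1/p) A ^ (1/p); the extra 1 keeps the bound positive whatever A >=
   0 is. *)
have AA : appell_const <=
    (1 + appell_const `^ (1 - p^-1)) * appell_const `^ p^-1.
  move: A0; rewrite le_eqVlt => /predU1P[<-|A0].
    by rewrite mulr_ge0 ?addr_ge0 ?powR_ge0.
  rewrite mulrDl mul1r -powRD; last by rewrite (gt_eqF A0) implybT.
  by rewrite subrK powRr1 ?(ltW A0)// lerDr powR_ge0.
have fp0 : 0 <= \int[mu]_(u in `[0, 1]) (f u `^ p * w u).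
  apply: Rintegral_ge0 => u; rewrite /= in_itv/= => u01.
  by rewrite mulr_ge0 ?powR_ge0// fac0.
rewrite powRM// mulrCA.
apply: le_trans (ler_pM A0 _ AA main) _.
  rewrite mulr_ge0 ?powR_ge0//; apply: Rintegral_ge0 => u.
  rewrite /= in_itv/= => u01.
  by rewrite mulr_ge0 ?fac0.
by rewrite /appell_bound le_eqVlt; apply/orP; left; apply/eqP; ring.
Qed.

(** * The two comparison regimes: f monotone, and f unimodal *)

(** For y <= x one has y / Y <= x / X, so f = X ^ -(al + be) Y ^ be has logarithmic derivative at
    least al x / X and is increasing. It serves as its own [g1], with B = 1 and kappa = 1 / al,
    while [g2] is 0. *)
Lemma appellF1_le_increasing (x y al be i j p L : R) :
  0 < x < 1 -> 0 <= y <= x -> 1 <= p -> 0 < al -> 0 <= be -> 0 < L ->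
  (forall u, 0 <= u <= 1 ->
     L * appell_factor x y (- i) (- j) u <= x / (1 - u * x)) ->
  L `^ (1 - p^-1) * appellF1 1 (i + (al + be)) (j - be) 2 x y <=
  appell_bound p al^-1 1 *
    appellF1 1 (i + p * (al + be)) (j - p * be) 2 x y `^ p^-1.
Proof.
move=> /andP[x0 x1] /andP[y0 yx] p1 al0 be0 L0 Lw.
have y1 : y < 1 := le_lt_trans yx x1.
apply: (@appellF1_threshold x y _ _ i j (al + be) be 0 0 1 0) => //.
  by rewrite invr_ge0 ltW.
move=> u u01 /=.
have X0 := onem_mul_gt0 x1 u01; have Y0 := onem_mul_gt0 y1 u01.
have YX : y / (1 - u * y) <= x / (1 - u * x).
  rewrite ler_pdivrMr// mulrAC ler_pdivlMr// !mulrBr !mulr1.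
  by rewrite (mulrCA y) (mulrCA x) (mulrC y) lerD2r.
have xX0 : 0 <= x / (1 - u * x) by rewrite divr_ge0 ?(ltW x0) ?(ltW X0).
have beYX := ler_wpM2l be0 YX.
have l1 : al * (x / (1 - u * x)) <=
    (al + be) * (x / (1 - u * x)) - be * (y / (1 - u * y)).
  by rewrite mulrDl -addrA lerDl subr_ge0.
rewrite !mul0r subrr !mul1r; split=> //.
  by apply: le_trans l1; rewrite mulr_ge0// ltW.
left; split=> //.
have f0 := appell_factor_gt0 (- (al + be)) be X0 Y0.
rewrite mulrCA [leRHS]mulrCA ler_pM2l//; apply: le_trans (Lw _ u01) _.
by rewrite [leRHS]mulrC ler_pdivlMr// mulrC.
Qed.

(* With t = a / (1 - u x), one has 1 - u y = (1 - t) (1 - u x) / (1 - a), and f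
   is proportional to t ^ al (1 - t) ^ be, which is comparable to the increasing
   t ^ al where t <= 1/2 and to the decreasing (1 - t) ^ be where t >= 1/2. *)
Lemma appellF1_le_unimodal (x y a al be p : R) :
  0 < x < 1 -> 0 < a < 1 - x -> y = x / (1 - a) ->
  1 <= p -> 0 < al -> 0 < be ->
  y `^ (1 - p^-1) * appellF1 1 (0 + (al + be)) (1 - be) 2 x y <=
  appell_bound p (2 / al + 2 / be) (2 `^ al + 2 `^ be) *
    appellF1 1 (0 + p * (al + be)) (1 - p * be) 2 x y `^ p^-1.
Proof.
move=> /andP[x0 x1] /andP[a0 ax] yE p1 al0 be0.
have a1 : 0 < 1 - a by lra.
have y1 : y < 1 by rewrite yE ltr_pdivrMr// mul1r; lra.
have y0 : 0 < y by rewrite yE divr_gt0.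
(* Up to constants, g1 = X ^ -al is t ^ al and g2 = a ^ -al (Y / X) ^ be is (1 - t) ^ be. The
   coefficient a ^ -al makes the comparison of [g2] with f uniform in a. *)
apply: (@appellF1_threshold x y _ _ 0 1 al 0 be be 1 (a `^ (- al))) => //.
- by rewrite addr_ge0// divr_ge0// ltW.
- exact: powR_ge0.
move=> u u01 /=.
have X0 := onem_mul_gt0 x1 u01; have Y0 := onem_mul_gt0 y1 u01.
have [u0 u1] := andP u01.
have ux0 : 0 <= u * x by rewrite mulr_ge0// ltW.
have uxx : u * x <= x by rewrite ler_piMl// ltW.
set X := 1 - u * x in X0 *; set Y := 1 - u * y in Y0 *.
(* This is t < 1, from a < 1 - x <= X. *)
have Xa : 0 < X - a by rewrite /X; lra.
have YE : Y = (X - a) / (1 - a).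
  by rewrite /Y /X yE; field; rewrite gt_eqF.
have yY : y / Y = x / (X - a).
  by rewrite YE yE; field; rewrite !gt_eqF.
have YX : Y <= X.
  rewrite YE ler_pdivrMr// mulrBr mulr1 lerD2l lerN2 ler_piMl ?(ltW a0)//.
  by rewrite /X; lra.
pose Z := (Y / X) `^ be.
pose P := X `^ (- al).
have P0 : 0 < P by exact: powR_gt0.
have ZE : X `^ (- be) * Y `^ be = Z.
  rewrite /Z powRM ?invr_ge0 ?(ltW X0) ?(ltW Y0)// mulrC; congr (_ * _).
  by rewrite -[X^-1]powR_inv1 ?(ltW X0)// -powRrM mulN1r.
have fE : appell_factor x y (- (al + be)) be u = P * Z.
  rewrite -ZE /appell_factor -/X -/Y mulrA -powRD ?(gt_eqF X0) ?implybT//.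
  by rewrite opprD.
have wE : appell_factor x y (- 0) (- 1) u = Y^-1.
  by rewrite /appell_factor -/Y oppr0 powRr0 mul1r powR_inv1// ltW.
have g1E : appell_factor x y (- al) 0 u = P.
  by rewrite /appell_factor -/X powRr0 mulr1.
have g2E : appell_factor x y (- be) be u = Z.
  by rewrite /appell_factor -/X -/Y ZE.
rewrite fE wE g1E g2E.
have Z0 : 0 < Z by rewrite powR_gt0// divr_gt0.
have pw1 : (1 : R) `^ be = 1 by rewrite powR1.
have Z1 : Z <= 1.
  rewrite -pw1 ge0_ler_powR ?nnegrE ?(ltW be0) ?divr_ge0 ?(ltW X0) ?(ltW Y0)//.
  by rewrite ler_pdivrMr// mul1r.
have xX : x / X <= x / (X - a) by rewrite ler_pM2l// lef_pV2 ?posrE//; lra.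
rewrite mul0r subr0 mul1r yY; split.
- by rewrite mulr_ge0 ?(ltW al0)// divr_ge0 ?(ltW x0) ?(ltW X0).
- by rewrite subr_ge0 ler_wpM2l// ltW.
rewrite (_ : y * (P * Z * Y^-1) = x / (X - a) * (P * Z)); last first.
  by rewrite -yY; ring.
have c1 : 2 / al * al <= (2 / al + 2 / be) * al.
  by rewrite ler_pM2r// lerDl divr_ge0// ltW.
have c2 : 2 / be * be <= (2 / al + 2 / be) * be.
  by rewrite ler_pM2r// lerDr divr_ge0// ltW.
move: c1 c2; rewrite !divfK ?gt_eqF//; set kap := _ + _ / be => c1 c2.
(* The split is at t = 1/2. If 2 a <= X, then X <= 2 (X - a) bounds L w = x / (X - a) by 2 x / X,
   and 2 Y / X >= 1 gives P <= 2 ^ be P Z. *)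
have [aX|Xa2] := leP (2 * a) X; [left|right]; split.
- rewrite (_ : kap * _ = x * P * (kap * al / X)); last by ring.
  rewrite (_ : x / _ * _ = x * P * (Z / (X - a))); last by ring.
  rewrite ler_wpM2l//; first by rewrite mulr_ge0 ?(ltW x0) ?(ltW P0).
  rewrite ler_pdivrMr// mulrAC ler_pdivlMr//.
  apply: (@le_trans _ _ (1 * X)); first by rewrite ler_pM2r.
  apply: (@le_trans _ _ (2 * (X - a))); first by lra.
  by rewrite ler_pM2r.
- rewrite mulrCA ler_peMr ?(ltW P0)// mulrDl.
  rewrite (@le_trans _ _ (2 `^ be * Z))//; last first.
    by rewrite lerDr mulr_ge0 ?powR_ge0 ?(ltW Z0).
  rewrite -powRM ?divr_ge0 ?(ltW X0) ?(ltW Y0)//.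
  rewrite -[leLHS]pw1 ge0_ler_powR ?nnegrE ?(ltW be0)//.
    by rewrite mulr_ge0 ?divr_ge0 ?(ltW X0) ?(ltW Y0).
  rewrite mulrA ler_pdivlMr// mul1r YE mulrA ler_pdivlMr// mulrBr mulr1.
  have : 0 <= X * a by rewrite mulr_ge0// ltW.
  by lra.
(* If X < 2 a, then x / X is at most half of x / (X - a), so the difference in l2 keeps at least the
   other half; moreover a ^ -al <= 2 ^ al P. *)
- have PA : P <= a `^ (- al).
    rewrite /P !powRN lef_pV2 ?posrE ?powR_gt0// ge0_ler_powR ?nnegrE ?ltW//.
    by lra.
  rewrite [leLHS]mulrC.
  rewrite (_ : kap * _ =
    a `^ (- al) * Z * (kap * be * (x / (X - a) - x / X))); last by ring.
  apply: ler_pM.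
  - by rewrite mulr_ge0 ?(ltW P0) ?(ltW Z0).
  - by rewrite divr_ge0 ?(ltW x0) ?(ltW Xa).
  - by rewrite ler_pM2r.
  apply: (@le_trans _ _ (2 * (x / (X - a) - x / X))); last first.
    by rewrite ler_wpM2r// subr_ge0.
  suff : 2 * (x / X) <= x / (X - a) by lra.
  rewrite mulrA ler_pdivrMr// mulrAC ler_pdivlMr// (mulrC 2) -mulrA ler_pM2l//.
  by lra.
- rewrite mulrA ler_pM2r// mulrDl (@le_trans _ _ (2 `^ al * P))//; last first.
    by rewrite lerDl mulr_ge0 ?powR_ge0 ?(ltW P0).
  rewrite /P !powRN ler_pdivlMr ?powR_gt0// mulrC ler_pdivrMr ?powR_gt0//.
  by rewrite -powRM ?(ltW a0)// ge0_ler_powR ?nnegrE ?mulr_ge0 ?ltW.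
Qed.

(** * The inequalities for c = -1, 0, 1 and the Gauss case *)

Lemma onem_ratio (a b : R) : 0 < a -> a < b -> 0 < 1 - a / b < 1.
Proof.
move=> a0 ab; have b0 := lt_trans a0 ab.
by rewrite subr_gt0 ltr_pdivrMr// mul1r ab gtrBl divr_gt0.
Qed.

Lemma ratio_onem (a b d : R) : b != 0 -> d != 0 ->
  (b - a) / (d * b) = (1 - a / b) / d.
Proof. by move=> b0 d0; field; rewrite b0 d0. Qed.

(** Here y = x / (1 + a) <= x, so f is increasing. With w = X ^ -1 Y ^ (-1/2) and L = (a / (1 + a))
    ^ (1/2) x, the condition L w <= x / X reduces to Y >= a / (1 + a). *)
Lemma appellF1_minus (eta1 eta2 p a b : R) :
  0 < eta1 -> 0 < eta2 -> 1 <= p -> 0 < a -> a < b ->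
  (a / (1 + a)) `^ (1 / 2 * inv_conjugate p) *
  (1 - a / b) `^ (inv_conjugate p) *
  appellF1 1 (1 + (eta1 + eta2) / 2) ((1 - eta2) / 2) 2
           (1 - a / b) ((b - a) / ((1 + a) * b))
  <= appell_bound p (eta1 / 2)^-1 1 *
     (appellF1 1 (1 + p * ((eta1 + eta2) / 2)) ((1 - p * eta2) / 2) 2
        (1 - a / b) ((b - a) / ((1 + a) * b))) `^ (1 / p).
Proof.
move=> e1 e2 p1 a0 ab; have b0 := lt_trans a0 ab.
have a1 : 0 < 1 + a by rewrite addr_gt0.
have x01 := onem_ratio a0 ab; have [x0 x1] := andP x01.
rewrite (inv_conjugateE p1) ratio_onem ?gt_eqF//; move: x01 x0 x1.
set x := 1 - a / b; set y := x / (1 + a) => x01 x0 x1.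
have y0 : 0 < y by rewrite divr_gt0.
have yx : y <= x.
  by rewrite ler_pdivrMr// ler_peMr ?(ltW x0)// lerDl ltW.
have r0 : 0 < a / (1 + a) by rewrite divr_gt0.
rewrite powRrM -powRM ?powR_ge0 ?(ltW x0)//.
have := @appellF1_le_increasing x y (eta1 / 2) (eta2 / 2) 1 (1 / 2) p
  ((a / (1 + a)) `^ (1 / 2) * x).
rewrite div1r.
rewrite (_ : 2^-1 - eta2 / 2 = (1 - eta2) / 2); last by ring.
rewrite (_ : eta1 / 2 + eta2 / 2 = (eta1 + eta2) / 2); last by ring.
rewrite (_ : 2^-1 - p * (eta2 / 2) = (1 - p * eta2) / 2); last by ring.
rewrite (div1r p); apply => //.
- by rewrite (ltW y0).
- by rewrite divr_gt0.
- by rewrite divr_ge0// ltW.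
- by rewrite mulr_gt0// powR_gt0.
move=> u u01; have X0 := onem_mul_gt0 x1 u01.
have [u0 u1] := andP u01.
(* Since x < 1, u y <= y <= 1 / (1 + a). *)
have rY : a / (1 + a) <= 1 - u * y.
  have uy : u * y <= y by rewrite ler_piMl ?(ltW y0).
  have : y <= 1 / (1 + a) by rewrite ler_pM2r ?invr_gt0 ?(ltW x1).
  have -> : 1 / (1 + a) = 1 - a / (1 + a) by field; rewrite gt_eqF.
  by lra.
have Y0 : 0 < 1 - u * y by apply: lt_le_trans rY.
rewrite /appell_factor powR_inv1 ?(ltW X0)// powRN.
rewrite [leLHS](_ : _ = x / (1 - u * x) *
  ((a / (1 + a)) `^ 2^-1 / (1 - u * y) `^ 2^-1)); last by ring.
rewrite ler_piMr ?divr_ge0 ?(ltW x0) ?(ltW X0)//.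
rewrite ler_pdivrMr ?powR_gt0// mul1r ge0_ler_powR ?nnegrE ?invr_ge0//.
  exact: ltW.
exact: ltW.
Qed.

(** The monotone case with y = x, w = Y ^ -1 and L = x, where L w = x / X exactly. *)
Lemma appellF1_zero (eta1 eta2 p a b : R) :
  0 < eta1 -> 0 < eta2 -> 1 <= p -> 0 < a -> a < b ->
  (1 - a / b) `^ (inv_conjugate p) *
  appellF1 1 ((eta1 + eta2) / 2) (1 - eta2 / 2) 2 (1 - a / b) (1 - a / b)
  <= appell_bound p (eta1 / 2)^-1 1 *
     (appellF1 1 (p * ((eta1 + eta2) / 2)) (1 - p * eta2 / 2) 2
       (1 - a / b) (1 - a / b)) `^ (1 / p).
Proof.
move=> e1 e2 p1 a0 ab.
have x01 := onem_ratio a0 ab; have [x0 x1] := andP x01.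
rewrite (inv_conjugateE p1); move: x01 x0 x1; set x := 1 - a / b => x01 x0 x1.
have := @appellF1_le_increasing x x (eta1 / 2) (eta2 / 2) 0 1 p x.
rewrite !add0r (_ : eta1 / 2 + eta2 / 2 = (eta1 + eta2) / 2); last by ring.
rewrite (_ : p * (eta2 / 2) = p * eta2 / 2); last by ring.
rewrite (div1r p); apply => //.
- by rewrite (ltW x0) lexx.
- by rewrite divr_gt0.
- by rewrite divr_ge0// ltW.
move=> u u01; have X0 := onem_mul_gt0 x1 u01.
by rewrite /appell_factor oppr0 powRr0 mul1r powR_inv1 ?(ltW X0).
Qed.

(** On the diagonal only the sum of the two exponents matters, and eta2 cancels from it on both
    sides; the value eta2 = 1 is chosen. *)
Lemma gauss2F1_zero (eta1 p a b : R) :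
  0 < eta1 -> 1 <= p -> 0 < a -> a < b ->
  (1 - a / b) `^ (inv_conjugate p) * gauss2F1 (1 + eta1 / 2) 1 2 (1 - a / b)
  <= appell_bound p (eta1 / 2)^-1 1 *
     (gauss2F1 (1 + p * eta1 / 2) 1 2 (1 - a / b)) `^ (1 / p).
Proof.
move=> e1 p1 a0 ab; have /andP[_ x1] := onem_ratio a0 ab.
have := appellF1_zero e1 ltr01 p1 a0 ab.
rewrite -(gauss2F1_factor ((eta1 + 1) / 2) _ x1).
rewrite -(gauss2F1_factor (p * ((eta1 + 1) / 2)) _ x1).
rewrite (_ : (eta1 + 1) / 2 + (1 - 1 / 2) = 1 + eta1 / 2); last by field.
by rewrite (_ : p * ((eta1 + 1) / 2) + (1 - p * 1 / 2) = 1 + p * eta1 / 2);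
  last by field.
Qed.

Lemma appellF1_plus (eta1 eta2 p a b : R) :
  0 < eta1 -> 0 < eta2 -> 1 <= p -> 0 < a -> a < b -> b < 1 ->
  (1 - a) `^ (- inv_conjugate p) *
  (1 - a / b) `^ (inv_conjugate p) *
  appellF1 1 ((eta1 + eta2) / 2) (1 - eta2 / 2) 2
           (1 - a / b) ((b - a) / ((1 - a) * b))
  <= appell_bound p (2 / (eta1 / 2) + 2 / (eta2 / 2))
       (2 `^ (eta1 / 2) + 2 `^ (eta2 / 2)) *
     (appellF1 1 (p * ((eta1 + eta2) / 2)) (1 - p * eta2 / 2) 2
        (1 - a / b) ((b - a) / ((1 - a) * b))) `^ (1 / p).
Proof.
move=> e1 e2 p1 a0 ab b1; have b0 := lt_trans a0 ab.
have a1 : 0 < 1 - a by rewrite subr_gt0 (lt_trans ab).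
have x01 := onem_ratio a0 ab; have [x0 x1] := andP x01.
(* Since 1 - x = a / b, the condition a < 1 - x expresses b < 1. *)
have ax : 0 < a < 1 - (1 - a / b).
  by rewrite a0 subKr ltr_pdivlMr//= gtr_pMr.
rewrite (inv_conjugateE p1) ratio_onem ?gt_eqF//; move: x01 x0 x1 ax.
set x := 1 - a / b; set y := x / (1 - a) => x01 x0 x1 ax.
(* The two prefactors combine into L ^ (1 - 1/p) with L = y. *)
have -> : (1 - a) `^ (- (1 - p^-1)) * x `^ (1 - p^-1) = y `^ (1 - p^-1).
  rewrite /y powRM ?invr_ge0 ?(ltW x0) ?(ltW a1)// mulrC; congr (_ * _).
  by rewrite -[(1 - a)^-1]powR_inv1 ?(ltW a1)// -powRrM mulN1r.
have := @appellF1_le_unimodal x y a (eta1 / 2) (eta2 / 2) p.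
rewrite !add0r (_ : eta1 / 2 + eta2 / 2 = (eta1 + eta2) / 2); last by ring.
rewrite (_ : p * (eta2 / 2) = p * eta2 / 2); last by ring.
by rewrite (div1r p); apply => //; rewrite divr_gt0.
Qed.

End AppellReverseBound.

Theorem theorem4p1 (R : realType) (eta1 eta2 p : R)
    (heta1 : 0 < eta1) (heta2 : 0 < eta2) (hp : 1 <= p) :
  [/\ forall c : R, c = -1 \/ c = 0 \/ c = 1 ->
      exists K : R, 0 < K /\
        forall a b : R, 0 < a -> a < b ->
        (b%:E < ((1 - heaviside (- c))%:E)^-1)%E ->
        (1 - c * a) `^ (- ((heaviside c + 1) / 2 * inv_conjugate p)) *
        a `^ ((1 - heaviside c) / 2 * inv_conjugate p) *
        (1 - a / b) `^ (inv_conjugate p) *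
        appellF1 1 (1 + (eta1 + eta2) / 2 - heaviside c)
                 ((heaviside c + 1 - eta2) / 2) 2
                 (1 - a / b) ((b - a) / ((1 - c * a) * b))
        <= K * (appellF1 1 (1 - heaviside c + p * ((eta1 + eta2) / 2))
                  ((heaviside c + 1 - p * eta2) / 2) 2
                  (1 - a / b) ((b - a) / ((1 - c * a) * b))) `^ (1 / p),
      exists K : R, 0 < K /\
        forall a b : R, 0 < a -> a < b ->
        (a / (1 + a)) `^ (1 / 2 * inv_conjugate p) *
        (1 - a / b) `^ (inv_conjugate p) *
        appellF1 1 (1 + (eta1 + eta2) / 2) ((1 - eta2) / 2) 2
                 (1 - a / b) ((b - a) / ((1 + a) * b))
        <= K * (appellF1 1 (1 + p * ((eta1 + eta2) / 2))
                  ((1 - p * eta2) / 2) 2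
                  (1 - a / b) ((b - a) / ((1 + a) * b))) `^ (1 / p),
      exists K : R, 0 < K /\
        forall a b : R, 0 < a -> a < b ->
        (1 - a / b) `^ (inv_conjugate p) *
        appellF1 1 ((eta1 + eta2) / 2) (1 - eta2 / 2) 2
                 (1 - a / b) (1 - a / b)
        <= K * (appellF1 1 (p * ((eta1 + eta2) / 2)) (1 - p * eta2 / 2) 2
                  (1 - a / b) (1 - a / b)) `^ (1 / p),
      exists K : R, 0 < K /\
        forall a b : R, 0 < a -> a < b ->
        (1 - a / b) `^ (inv_conjugate p) *
        gauss2F1 (1 + eta1 / 2) 1 2 (1 - a / b)
        <= K * (gauss2F1 (1 + p * eta1 / 2) 1 2 (1 - a / b)) `^ (1 / p)
    & exists K : R, 0 < K /\
        forall a b : R, 0 < a -> a < b -> b < 1 ->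
        (1 - a) `^ (- inv_conjugate p) *
        (1 - a / b) `^ (inv_conjugate p) *
        appellF1 1 ((eta1 + eta2) / 2) (1 - eta2 / 2) 2
                 (1 - a / b) ((b - a) / ((1 - a) * b))
        <= K * (appellF1 1 (p * ((eta1 + eta2) / 2)) (1 - p * eta2 / 2) 2
                  (1 - a / b) ((b - a) / ((1 - a) * b))) `^ (1 / p)].
Proof.
have B1 : 0 < appell_bound p (eta1 / 2)^-1 1.
  by apply: appell_bound_gt0 => //; rewrite invr_ge0 divr_ge0 ?(ltW heta1).
have B2 : 0 < appell_bound p (2 / (eta1 / 2) + 2 / (eta2 / 2))
                (2 `^ (eta1 / 2) + 2 `^ (eta2 / 2)).
  apply: appell_bound_gt0; last by rewrite addr_ge0 ?powR_ge0.
  by rewrite addr_ge0 ?divr_ge0 ?(ltW heta1) ?(ltW heta2).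
have lt1 : (0 <= -1 :> R) = false by rewrite oppr_ge0 ler10.
split.
- move=> c [->|[->|->]]; rewrite /heaviside.
  (* c = -1: H(c) = 0 and H(-c) = 1, so b ranges up to +oo; the powers of 1 + a and a combine into
     one of a / (1 + a). *)
  + rewrite lt1 opprK ler01 !subr0 !add0r.
    exists (appell_bound p (eta1 / 2)^-1 1); split=> // a b a0 ab _.
    have := appellF1_minus heta1 heta2 hp a0 ab.
    have a1 : 0 < 1 + a by rewrite addr_gt0.
    rewrite mulN1r opprK powRM ?invr_ge0 ?(ltW a0) ?(ltW a1)//.
    rewrite -[(1 + a)^-1]powR_inv1 ?(ltW a1)// -powRrM mulN1r.
    by rewrite [a `^ _ * _]mulrC.
  (* c = 0: H(0) = 1, so the first two prefactors are 1 and the variables coincide. *)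
  + rewrite oppr0 lexx !subrr.
    exists (appell_bound p (eta1 / 2)^-1 1); split=> // a b a0 ab _.
    have b0 := lt_trans a0 ab.
    have := appellF1_zero heta1 heta2 hp a0 ab.
    rewrite !mul0r subr0 !mul1r powR1 powRr0 !mul1r add0r.
    have -> : (b - a) / b = 1 - a / b by field; rewrite gt_eqF.
    rewrite (_ : 1 + (eta1 + eta2) / 2 - 1 = (eta1 + eta2) / 2); last by ring.
    rewrite (_ : (1 + 1 - eta2) / 2 = 1 - eta2 / 2); last by field.
    by rewrite (_ : (1 + 1 - p * eta2) / 2 = 1 - p * eta2 / 2); last by field.
  (* c = 1: H(c) = 1 and H(-c) = 0, so the bound on b is 1. *)
  + rewrite lt1 ler01 !subr0 subrr.
    exists (appell_bound p (2 / (eta1 / 2) + 2 / (eta2 / 2))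
                (2 `^ (eta1 / 2) + 2 `^ (eta2 / 2))); split=> // a b a0 ab.
    rewrite inve1 lte_fin => b1.
    have := appellF1_plus heta1 heta2 hp a0 ab b1.
    rewrite !mul0r !mul1r powRr0 mulr1 add0r.
    rewrite (_ : 1 + (eta1 + eta2) / 2 - 1 = (eta1 + eta2) / 2); last by ring.
    rewrite (_ : (1 + 1 - eta2) / 2 = 1 - eta2 / 2); last by field.
    rewrite (_ : (1 + 1 - p * eta2) / 2 = 1 - p * eta2 / 2); last by field.
    by rewrite (_ : (1 + 1) / 2 = 1) ?mul1r; last by field.
- exists (appell_bound p (eta1 / 2)^-1 1); split=> // a b.
  exact: appellF1_minus.
- exists (appell_bound p (eta1 / 2)^-1 1); split=> // a b.
  exact: appellF1_zero.
- exists (appell_bound p (eta1 / 2)^-1 1); split=> // a b.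
  exact: gauss2F1_zero.
exists (appell_bound p (2 / (eta1 / 2) + 2 / (eta2 / 2))
                (2 `^ (eta1 / 2) + 2 `^ (eta2 / 2))); split=> // a b.
exact: appellF1_plus.
Qed.
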